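(* Let $N\ge 2$ be an integer and let $\alpha\in\mathbb{R}$ with $0<\alpha\le\sqrt N-1$. Suppose $I_\alpha=\Delta_d\cup\Delta_{d-1}$, where $d=d(\alpha)$ (i.e. $I_\alpha$ consists of exactly two cylinder sets). If $T_\alpha(\alpha)\ge f_{d-1}$ and $T_\alpha(\alpha+1)\le f_d$, then $I_\alpha$ is gapless.
   Context: For an integer $N\ge 2$ and a real $\alpha$ with $0<\alpha\le\sqrt N-1$, put $I_\alpha=[\alpha,\alpha+1]$. Define the digit function $d:I_\alpha\to\mathbb{N}$ by $d(x)=\lfloor N/x-\alpha\rfloor$ if $x\in(\alpha,\alpha+1]$, or if $x=\alpha$ and $N/\alpha-\alpha\notin\mathbb{Z}$; and $d(\alpha)=\lfloor N/\alpha-\alpha\rfloor-1$ if $N/\alpha-\alpha\in\mathbb{Z}$. The $N$-expansion map $T_\alpha:I_\alpha\to I_\alpha$ is $T_\alpha(x)=N/x-d(x)$. The cylinder sets are $\Delta_i=\{x\in I_\alpha: d(x)=i\}$, which are non-empty exactly for $d(\alpha+1)\le i\le d(\alpha)$. Writing $I_\alpha=\Delta_d\cup\dots\cup\Delta_{d-m}$ means that $d=d(\alpha)$ and $d-m=d(\alpha+1)$, so there are exactly $m+1$ cylinder sets. The fixed point of $T_\alpha$ in $\Delta_i$ is $f_i=f_i(N)=\frac{\sqrt{4N+i^2}-i}{2}$. A gap of $I_\alpha$ is a (non-empty) open interval $(a,b)\subset I_\alpha$ that is maximal with respect to the property: for Lebesgue-almost every $x\in I_\alpha$ there is $n_0\in\mathbb{N}$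 such that $T_\alpha^n(x)\notin(a,b)$ for all $n\ge n_0$. $I_\alpha$ is gapless if it has no gaps. *)

(* Defs.v *)
From HB Require Import structures.
From mathcomp Require Import all_boot all_order all_algebra.
From mathcomp Require Import all_classical all_reals all_analysis.

Set Implicit Arguments.
Unset Strict Implicit.
Unset Printing Implicit Defensive.

Import Order.TTheory GRing.Theory Num.Theory.
Local Open Scope classical_set_scope.
Local Open Scope ring_scope.

Definition domain {R : realType} (alpha : R) : set R :=
  `[alpha, alpha + 1]%classic.

(* Only the values on [domain alpha] are meaningful. Digits are integers in
   [int]; for N >= 2 and 0 < alpha <= sqrt N - 1 they are positive on
   [domain alpha]. Lowering the digit by one at alpha when N / alpha - alpha
   is an integer makes it the right limit of the digits there. *)
Definition digit {R : realType} (N : nat) (alpha x : R) : int :=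
  if (x == alpha) && (N%:R / alpha - alpha \is a Num.int)
  then Num.floor (N%:R / alpha - alpha) - 1
  else Num.floor (N%:R / x - alpha).

(* For N >= 2 and 0 < alpha <= sqrt N - 1 this maps [domain alpha] to itself,
   so its iterates from a point of [domain alpha] never leave that interval. *)
Definition expansion_map {R : realType} (N : nat) (alpha x : R) : R :=
  N%:R / x - (digit N alpha x)%:~R.

Definition cylinder {R : realType} (N : nat) (alpha : R) (i : int) : set R :=
  [set x | domain alpha x /\ digit N alpha x = i].

(* The positive solution of x = N / x - i. *)
Definition fixed_point {R : realType} (N : nat) (i : int) : R :=
  (Num.sqrt (4 * N%:R + i%:~R ^+ 2) - i%:~R) / 2.

Definition eventually_avoided {R : realType} (N : nat) (alpha a b : R) : Prop :=
  {ae @lebesgue_measure R, forall x, domain alpha x ->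
    exists n0 : nat, forall n : nat, (n0 <= n)%N ->
      ~ `]a, b[%classic (iter n (expansion_map N alpha) x)}.

Definition is_gap {R : realType} (N : nat) (alpha a b : R) : Prop :=
  [/\ a < b,
      `]a, b[%classic `<=` domain alpha,
      eventually_avoided N alpha a b &
      forall a' b' : R,
        `]a', b'[%classic `<=` domain alpha ->
        eventually_avoided N alpha a' b' ->
        `]a, b[%classic `<=` `]a', b'[%classic ->
        `]a', b'[%classic = `]a, b[%classic].

Definition gapless {R : realType} (N : nat) (alpha : R) : Prop :=
  forall a b : R, ~ is_gap N alpha a b.

(* Main.v *)
Require Import Defs.
From HB Require Import structures.
From mathcomp Require Import all_boot all_order all_algebra.
From mathcomp Require Import all_classical all_reals all_analysis.
From mathcomp Require Import ring lra.

Set Implicit Arguments.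
Unset Strict Implicit.
Unset Printing Implicit Defensive.

Import Order.TTheory GRing.Theory Num.Theory.
Import numFieldNormedType.Exports.
Local Open Scope classical_set_scope.
Local Open Scope ring_scope.

(** Almost every orbit visits every open subinterval of [[alpha, alpha + 1]]
    infinitely often, so no interval is eventually avoided.

    Write [a] for [alpha], [p = N / (d + a)] for the point separating the two
    cylinders, and [f < p < g] for the fixed points of the two branches. The
    second iterate [T ^ 2] is uniformly expanding, because [x * T x <= N - a];
    hence every interval grows under iteration until it contains [p], where it
    is cut in two. The danger is that cutting outweighs growing. It does not:
    an interval around [p] either contains one of the halves [[f, p]], [[p, g]],
    or lies inside [(f, g)], and then each of its two parts is mapped homeomorphically
    by [T ^ 3], unless its second image already contains a half. The inverse
    slopes of these two maps are bounded by numbers whose sum is less than [1]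
    (kappa_sum_lt1). That inequality is the quantitative content of the
    hypotheses [T a >= g] and [T (a + 1) <= f]: they say that [T ^ 2] stretches
    both [(f, p)] and [(p, g)] over [(f, g)] (overlap_sum_le).

    Consequently the points of an interval around which no subinterval is ever
    expanded to one containing [[f, p]] or [[p, g]] can be covered, for each [m],
    by finitely many intervals of total length at most the [m]-th power of that
    sum, and are negligible (stuck_negligible). From [(f, p)] and from
    [(p, g)] some iterate leads into any prescribed interval [(u, v)], since
    the two branches and the overlap carry parts of them over everything
    (reaches_within_cut).

    The iterates of [T] are piecewise Moebius maps whose inverses have nonnegative
    coefficients, so their distortion is bounded by a constant
    (moebius_distortion). Around almost every point there are therefore
    arbitrarily small intervals a fixed proportion of which enters [(u, v)] at
    a time beyond any given [n0]. By the Lebesgue density theorem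
    (porous_negligible) the points that do not enter [(u, v)] after time [n0]
    form a negligible set, for each [n0]. *)

(** * Two overlapping branches *)

(** What the dynamics retains of the two-cylinder situation: a decreasing branch
    on each side of the cut [p], the fixed points [f] and [g] of the left and of
    the right branch, and the hypotheses that the image of the left end point
    reaches [g] and that of the right end point reaches down to [f]. *)
Record overlapping_map {R : realType} (N a d p f g : R) (T : R -> R) : Prop :=
  OverlappingMap {
  om_a_gt0 : 0 < a;
  om_a1_sqr : (a + 1) ^+ 2 <= N;
  om_d_ge2 : 2 <= d;
  om_cut : p * (d + a) = N;
  om_f_gt0 : 0 < f;
  om_fixf : f * (f + d) = N;
  om_g_gt0 : 0 < g;
  om_fixg : g * (g + (d - 1)) = N;
  om_left_ge : g <= N / a - d;
  om_left_le : N / a - d <= a + 1;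
  om_right_ge : a <= N / (a + 1) - (d - 1);
  om_right_le : N / (a + 1) - (d - 1) <= f;
  om_Tleft : forall x, a < x < p -> T x = N / x - d;
  om_Tright : forall x, p < x < a + 1 -> T x = N / x - (d - 1) }.

Section Inequalities.
Variables (R : realType) (N a d p f g : R) (T : R -> R).
Hypothesis H : overlapping_map N a d p f g T.

Lemma a_gt0 : 0 < a. Proof. exact: om_a_gt0 H. Qed.
Lemma a1_gt0 : 0 < a + 1. Proof. by have := a_gt0; lra. Qed.
Lemma N_gt0 : 0 < N.
Proof. by apply: lt_le_trans (om_a1_sqr H); rewrite exprn_gt0 ?a1_gt0. Qed.

(** Clearing denominators turns the bounds on the images of the end points into
    polynomial inequalities. *)
Lemma left_image_ge : a * (g + d) <= N.
Proof.
by have := om_left_ge H; rewrite lerBrDr ler_pdivlMr ?a_gt0// mulrC.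
Qed.
Lemma left_image_le : N <= a * (a + 1 + d).
Proof.
by have := om_left_le H; rewrite lerBlDr ler_pdivrMr ?a_gt0// mulrC.
Qed.
Lemma right_image_le : N <= (a + 1) * (f + (d - 1)).
Proof.
by have := om_right_le H; rewrite lerBlDr ler_pdivrMr ?a1_gt0// mulrC.
Qed.

Lemma f_lt_g : f < g.
Proof.
have f0 := om_f_gt0 H; have g0 := om_g_gt0 H; have d2 := om_d_ge2 H.
have hf := om_fixf H; have hg := om_fixg H.
rewrite ltNge; apply/negP => gf; nra.
Qed.

Lemma a_lt_f : a < f.
Proof.
have a0 := a_gt0; have f0 := om_f_gt0 H; have d2 := om_d_ge2 H.
have h1 := left_image_ge; have hf := om_fixf H; have fg := f_lt_g.
by rewrite ltNge; apply/negP => ?; nra.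
Qed.

Lemma f_lt_p : f < p.
Proof.
have a0 := a_gt0; have f0 := om_f_gt0 H; have d2 := om_d_ge2 H.
have hf := om_fixf H; have hp := om_cut H; have af := a_lt_f.
by rewrite ltNge; apply/negP => ?; nra.
Qed.

Lemma p_gt0 : 0 < p. Proof. by have := f_lt_p; have := om_f_gt0 H; lra. Qed.

Lemma g_lt_a1 : g < a + 1.
Proof.
have a0 := a_gt0; have g0 := om_g_gt0 H; have d2 := om_d_ge2 H.
have h1 := right_image_le; have hg := om_fixg H; have fg := f_lt_g.
by rewrite ltNge; apply/negP => ?; nra.
Qed.

Lemma p_lt_g : p < g.
Proof.
have a0 := a_gt0; have g0 := om_g_gt0 H; have d2 := om_d_ge2 H.
have hg := om_fixg H; have hp := om_cut H; have ga := g_lt_a1.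
by rewrite ltNge; apply/negP => ?; nra.
Qed.

(** As [T] expands, the image [(a, f)] of [(f, p)] is the longer of the two, so
    [f] lies beyond the arithmetic, hence the geometric, mean of [a] and [p]. *)
Lemma ap_le_f2 : a * p <= f ^+ 2.
Proof.
have a0 := a_gt0; have f0 := om_f_gt0 H; have d2 := om_d_ge2 H.
have hf := om_fixf H; have hp := om_cut H; have af := a_lt_f.
have fp := f_lt_p; have pg := p_lt_g; have g1 := g_lt_a1; have h := om_a1_sqr H.
have pf : p * f <= N by nra.
have eq : (f - a) * (p * f) = N * (p - f) by nra.
have : p - f <= f - a by nra.
nra.
Qed.

(** The overlap hypotheses say that the second iterate stretches [(f, p)] and
    [(p, g)] each over [(f, g)]. As the distance of [N / x] and [N / y] is exactly
    [N * `|x - y| / (x * y)], they read [(g - f) * p * a * f ^+ 2 <= N ^+ 2 * (p - f)]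
    and [(g - f) * p * (a + 1) * g ^+ 2 <= N ^+ 2 * (g - p)]; their sum is the
    claim times [g - f]. *)
Lemma overlap_sum_le : p * (a * f ^+ 2 + (a + 1) * g ^+ 2) <= N ^+ 2.
Proof.
have a0 := a_gt0; have f0 := om_f_gt0 H; have d2 := om_d_ge2 H.
have hf := om_fixf H; have hp := om_cut H; have hg := om_fixg H.
have af := a_lt_f; have fp := f_lt_p; have pg := p_lt_g; have g1 := g_lt_a1.
have N0 := N_gt0; have g0 := om_g_gt0 H; have p0 := p_gt0.
have h1 := left_image_ge; have h2 := right_image_le.
have e1 : (f - a) * (p * f) = N * (p - f) by nra.
have e2 : (a + 1 - g) * (p * g) = N * (g - p) by nra.
have k1 : (g - f) * (a * f) <= N * (f - a) by nra.
have k2 : (g - f) * ((a + 1) * g) <= N * (a + 1 - g) by nra.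
have l1 : (g - f) * (p * (a * f ^+ 2)) <= N ^+ 2 * (p - f).
  have -> : (g - f) * (p * (a * f ^+ 2)) = ((g - f) * (a * f)) * (p * f) by ring.
  have -> : N ^+ 2 * (p - f) = (N * (f - a)) * (p * f).
    by rewrite -mulrA e1; ring.
  by rewrite ler_wpM2r// mulr_ge0 ?ltW.
have l2 : (g - f) * (p * ((a + 1) * g ^+ 2)) <= N ^+ 2 * (g - p).
  have -> : (g - f) * (p * ((a + 1) * g ^+ 2))
    = ((g - f) * ((a + 1) * g)) * (p * g) by ring.
  have -> : N ^+ 2 * (g - p) = (N * (a + 1 - g)) * (p * g).
    by rewrite -mulrA e2; ring.
  by rewrite ler_wpM2r// mulr_ge0 ?ltW.
have gf0 : 0 < g - f by lra.
rewrite -(ler_pM2l gf0) mulrDr mulrDr.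
by apply: le_trans (lerD l1 l2) _; rewrite le_eqVlt; apply/orP; left; apply/eqP; ring.
Qed.

(** [kappaL] and [kappaR] bound the inverse slope of the third iterate of [T] on
    the left and on the right of the cut. There [T ^ 3] has slope of absolute value
    [N ^ 3 / (x * T x * T (T x)) ^ 2], and [p * a * (a + 1)] and [g * (a + 1) * p]
    bound the product of the three points. *)
Definition kappaL := (p * a * (a + 1)) ^+ 2 / N ^+ 3.
Definition kappaR := (g * (a + 1) * p) ^+ 2 / N ^+ 3.

Lemma kappaL_ge0 : 0 <= kappaL.
Proof.
by rewrite /kappaL divr_ge0 ?sqr_ge0// exprn_ge0// ltW// N_gt0.
Qed.

Lemma kappaR_ge0 : 0 <= kappaR.
Proof.
by rewrite /kappaR divr_ge0 ?sqr_ge0// exprn_ge0// ltW// N_gt0.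
Qed.

(** Cutting an interval at [p] is harmless: after three more steps the two halves
    have in weighted total gained more than the cut lost. The factor
    [(a + 1) ^+ 2 / N <= 1] leaves [p * (a * (a * p) + p * g ^+ 2) < N ^+ 2], which
    [a * p <= f ^+ 2] and [p < a + 1] reduce to the overlap inequality. *)
Lemma kappa_sum_lt1 : kappaL + kappaR < 1.
Proof.
have a0 := a_gt0; have N0 := N_gt0; have p0 := p_gt0; have g0 := om_g_gt0 H.
have f0 := om_f_gt0 H; have fp := f_lt_p; have pg := p_lt_g; have g1 := g_lt_a1.
rewrite -mulrDl ltr_pdivrMr ?exprn_gt0// mul1r.
have -> : (p * a * (a + 1)) ^+ 2 + (g * (a + 1) * p) ^+ 2
  = (a + 1) ^+ 2 * (p * (a * (a * p) + p * g ^+ 2)) by ring.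
have -> : N ^+ 3 = N * N ^+ 2 by ring.
apply: (@le_lt_trans _ _ (N * (p * (a * (a * p) + p * g ^+ 2)))).
  rewrite ler_wpM2r ?(om_a1_sqr H)//.
  by rewrite !(mulr_ge0, addr_ge0, exprn_ge0)// ltW.
rewrite (ltr_pM2l N0); apply: lt_le_trans overlap_sum_le.
rewrite (ltr_pM2l p0); apply: ler_ltD.
  by rewrite (ler_pM2l a0) ap_le_f2.
by rewrite ltr_pM2r ?exprn_gt0//; lra.
Qed.
End Inequalities.

(** * Covers of small total length *)

Section Cover.
Variable R : realType.
Implicit Types (E F : set R) (s : seq (R * R)) (t k : R).

(** Finite covers by closed intervals stand in for outer measure: lengths stay real
    numbers, and pulling a cover back along an expanding map is elementary. *)
Definition cover_le E t := exists s,
  [/\ all (fun J => J.1 <= J.2) s,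
      forall x, E x -> has (fun J => J.1 <= x <= J.2) s &
      \sum_(J <- s) (J.2 - J.1) <= t].

Lemma cover_le_sub E F t : E `<=` F -> cover_le F t -> cover_le E t.
Proof. by move=> EF [s [h1 h2 h3]]; exists s; split => // x /EF /h2. Qed.

Lemma cover_le_itv (u v : R) t : u <= v -> v - u <= t ->
  cover_le [set x | u <= x <= v] t.
Proof.
move=> uv h; exists [:: (u, v)]; split => /=; first by rewrite uv.
  by move=> x ->.
by rewrite big_seq1.
Qed.

Lemma cover_leU E F t t' : cover_le E t -> cover_le F t' ->
  cover_le (E `|` F) (t + t').
Proof.
move=> [s [h1 h2 h3]] [s' [h1' h2' h3']]; exists (s ++ s'); split.
- by rewrite all_cat h1.
- by move=> x [/h2|/h2'] h; rewrite has_cat h ?orbT.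
- by rewrite big_cat/= lerD.
Qed.

(** The part of [E] that [h] sends into an interval [J] has diameter at most [k]
    times the length of [J], hence fits in an interval of that length. *)
Lemma cover_le_expanding E F (h : R -> R) k t : 0 <= k ->
  (forall x, E x -> F (h x)) ->
  (forall x y, E x -> E y -> `|x - y| <= k * `|h x - h y|) ->
  cover_le F t -> cover_le E (k * t).
Proof.
move=> k0 EF hk [s [h1 h2 h3]].
have pull (J : R * R) : exists c, forall x, E x ->
    J.1 <= h x <= J.2 -> c <= x <= c + k * (J.2 - J.1).
  pose G := [set x | E x /\ J.1 <= h x <= J.2].
  have close x y : G x -> G y -> x - y <= k * (J.2 - J.1).
    move=> [Ex /andP[x1 x2]] [Ey /andP[y1 y2]].
    apply: (le_trans (ler_norm _)); apply: (le_trans (hk _ _ Ex Ey)).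
    by rewrite ler_wpM2l// ler_norml; apply/andP; split; lra.
  have [[x0 Gx0]|G0] := pselect (G !=set0); last first.
    by exists 0 => x Ex hx; exfalso; apply: G0; exists x.
  have lG x : G x -> lbound G (x - k * (J.2 - J.1)).
    by move=> Gx y Gy; have := close _ _ Gx Gy; lra.
  have iG : has_inf G by split; [exists x0 | exists (x0 - k * (J.2 - J.1)); exact: lG].
  exists (inf G) => x Ex hx; apply/andP; split; first exact: (ge_inf iG.2).
  by rewrite -lerBlDr; apply: lb_le_inf; [exists x0|exact: lG].
have [c cP] := choice pull.
exists [seq (c J, c J + k * (J.2 - J.1)) | J <- s]; split.
- rewrite all_map; apply: sub_all h1 => J /= J12.
  by rewrite lerDl mulr_ge0// subr_ge0.
- move=> x Ex; have /hasP[J Js hJ] := h2 _ (EF _ Ex).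
  by rewrite has_map; apply/hasP; exists J => //=; exact: cP.
- rewrite big_map /=; under eq_bigr do rewrite addrC addKr.
  by rewrite -mulr_sumr ler_wpM2l.
Qed.

Lemma cover_le_negligible E : (forall t, 0 < t -> cover_le E t) ->
  (@lebesgue_measure R).-negligible E.
Proof.
move=> hE; apply/negligible_outer_measure; apply/eqP.
rewrite eq_le outer_measure_ge0 andbT; apply/lee_addgt0Pr => t t0.
rewrite add0e; have [s [h1 h2 h3]] := hE _ t0.
apply: le_trans (_ : (\sum_(J <- s) (J.2 - J.1))%:E <= _)%E; last by rewrite lee_fin.
elim: s E h1 h2 {hE h3} => [|J s IH] E /= h1 h2.
  have -> : E = set0 by apply/seteqP; split => // x /h2.
  by rewrite outer_measure0 big_nil.
case/andP: h1 => J12 h1.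
have -> : E = (E `&` [set x | ~~ (J.1 <= x <= J.2)]) `|` (E `&` `[J.1, J.2]%classic).
  rewrite -setIUr; apply/seteqP; split => [x Ex|x []//]; split => //=.
  by rewrite in_itv/=; case: (_ <= _ <= _); [right|left].
apply: (le_trans (outer_measureU2 _ _ _)).
rewrite big_cons EFinD [leLHS]addeC; apply: leeD; last first.
  by apply: (IH _ h1) => x [/h2/orP[hx /= /negP[]|]].
apply: (@le_trans _ _ (@lebesgue_measure R `[J.1, J.2]%classic)).
  exact: le_outer_measure.
rewrite lebesgue_measure_itv /= lte_fin; case: ifP => // _.
by rewrite lee_fin subr_ge0.
Qed.
End Cover.

Lemma expr_lt_eps (R : realType) (z e : R) : 0 <= z -> z < 1 -> 0 < e ->
  exists k, z ^+ k < e.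
Proof.
move=> z0 z1 e0.
have /cvgrPdist_lt/(_ _ e0)[k _ hk] : (fun n => z ^+ n) @ \oo --> (0 : R).
  by apply: cvg_expr; rewrite ger0_norm.
exists k; have := hk k (leqnn k).
by rewrite /= sub0r normrN ger0_norm ?exprn_ge0.
Qed.

(** * Inverse branches and their distortion *)

Section Moebius.
Variable R : realType.
Implicit Types (A B C D y z : R).

Definition moebius A B C D y := (A + B * y) / (C + D * y).

Lemma moebiusB A B C D y z : 0 < C + D * y -> 0 < C + D * z ->
  moebius A B C D y - moebius A B C D z =
  (B * C - A * D) * (y - z) / ((C + D * y) * (C + D * z)).
Proof.
by move=> hy hz; rewrite /moebius; field; rewrite !lt0r_neq0.
Qed.

(** Bounded distortion with a constant independent of the map: a denominator
    [C + D * y] with nonnegative coefficients varies by at most the factor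
    [(a + 1) / a] over [[a, a + 1]]. *)
Lemma moebius_distortion A B C D (a c1 c2 k1 k2 : R) : 0 < a ->
  0 <= A -> 0 <= B -> 0 < C -> 0 <= D ->
  a <= c1 -> c1 < c2 -> c2 <= a + 1 -> c1 <= k1 -> k1 < k2 -> k2 <= c2 ->
  (a / (a + 1)) ^+ 2 * (k2 - k1) *
    `|moebius A B C D c2 - moebius A B C D c1| <=
  `|moebius A B C D k2 - moebius A B C D k1|.
Proof.
move=> a0 A0 B0 C0 D0 ac1 c12 c2a ck1 k12 k2c.
have a1 : 0 < a + 1 by lra.
have [ak1 ak2 ac2] : [/\ a <= k1, a <= k2 & a <= c2] by split; lra.
have [k1a k2a c1a] : [/\ k1 <= a + 1, k2 <= a + 1 & c1 <= a + 1] by split; lra.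
have dc1 : c2 - c1 <= 1 by lra.
have den y : a <= y -> 0 < C + D * y.
  by move=> ay; rewrite ltr_pwDl// mulr_ge0//; lra.
have [p1 p2 q1 q2] : [/\ 0 < C + D * c1, 0 < C + D * c2, 0 < C + D * k1
    & 0 < C + D * k2] by split; exact: den.
rewrite !moebiusB// !normrM !normfV !normrM.
rewrite (gtr0_norm p1) (gtr0_norm p2) (gtr0_norm q1) (gtr0_norm q2).
rewrite (@gtr0_norm _ (c2 - c1)) ?subr_gt0// (@gtr0_norm _ (k2 - k1)) ?subr_gt0//.
set E := `|_|; have E0 : 0 <= E by exact: normr_ge0.
have ratio y z : a <= y <= a + 1 -> a <= z <= a + 1 ->
    a / (a + 1) * (C + D * y) <= C + D * z.
  move=> /andP[y1 y2] /andP[z1 z2]; rewrite -mulrA [_^-1 * _]mulrC mulrA.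
  rewrite ler_pdivrMr//.
  have : D * y * a <= D * (a + 1) * z.
    rewrite -!mulrA ler_wpM2l// [y * a]mulrC.
    by apply: (@le_trans _ _ (a * (a + 1))); [rewrite ler_pM2l|rewrite mulrC ler_pM2l//; lra].
  have : C * a <= C * (a + 1) by rewrite ler_pM2l//; lra.
  lra.
have r1 : a / (a + 1) * (C + D * k1) <= C + D * c1 by apply: ratio; apply/andP.
have r2 : a / (a + 1) * (C + D * k2) <= C + D * c2 by apply: ratio; apply/andP.
have t0 : 0 <= a / (a + 1) by rewrite divr_ge0// ltW.
rewrite ler_pdivlMr ?mulr_gt0//.
have -> : (a / (a + 1)) ^+ 2 * (k2 - k1) *
    (E * (c2 - c1) / ((C + D * c2) * (C + D * c1))) *
    ((C + D * k2) * (C + D * k1)) =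
  E * (k2 - k1) * ((c2 - c1) * ((a / (a + 1) * (C + D * k1)) *
    (a / (a + 1) * (C + D * k2)) / ((C + D * c1) * (C + D * c2)))).
  by field; rewrite !lt0r_neq0.
rewrite ler_piMr// ?mulr_ge0 ?subr_ge0 ?(ltW k12)//.
have le1 : a / (a + 1) * (C + D * k1) * (a / (a + 1) * (C + D * k2)) /
    ((C + D * c1) * (C + D * c2)) <= 1.
  rewrite ler_pdivrMr ?mulr_gt0// mul1r.
  by apply: ler_pM => //; rewrite mulr_ge0// ltW.
apply: mulr_ile1 => //; first by rewrite subr_ge0 ltW.
by apply: divr_ge0; do ?apply: mulr_ge0 => //; exact: ltW.
Qed.
End Moebius.

Section Branch.
Variables (R : realType) (N a : R) (T : R -> R).
Hypotheses (a0 : 0 < a) (N0 : 0 < N).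

(** [branch n l r c1 c2 A B C D]: the [n]-th iterate of [T] maps [(l, r)]
    homeomorphically onto [(c1, c2)], and its inverse is the Moebius map with
    coefficients [A], [B], [C], [D], which are nonnegative as the digits are. The
    last field, an upper bound on the stretching, shows that a short [(l, r)]
    needs a large [n] to be mapped onto a long interval. *)
Record branch (n : nat) (l r c1 c2 A B C D : R) : Prop := Branch {
  br_A : 0 <= A; br_B : 0 <= B; br_C : 0 < C; br_D : 0 <= D;
  br_al : a <= l; br_lr : l < r; br_ra : r <= a + 1;
  br_ac : a <= c1; br_c : c1 < c2; br_ca : c2 <= a + 1;
  br_ends : (moebius A B C D c1 = l /\ moebius A B C D c2 = r) \/
            (moebius A B C D c1 = r /\ moebius A B C D c2 = l);
  br_inv : forall x, l < x < r ->
    c1 < iter n T x < c2 /\ moebius A B C D (iter n T x) = x;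
  br_exp : c2 - c1 <= (N / a ^+ 2) ^+ n * (r - l) }.

Lemma branch_id l r : a <= l -> l < r -> r <= a + 1 -> branch 0 l r l r 0 1 1 0.
Proof.
move=> al lr ra; split => //.
- by left; rewrite /moebius !mul0r !add0r !addr0 !divr1 !mul1r.
- by move=> x xlr; split => //; rewrite /moebius mul0r add0r addr0 divr1 mul1r.
- by rewrite expr0 mul1r.
Qed.

Lemma branch_cons n l r c1 c2 A B C D i : 0 < i ->
  a <= N / (i + r) -> N / (i + l) <= a + 1 ->
  (forall x, N / (i + r) < x < N / (i + l) -> T x = N / x - i) ->
  branch n l r c1 c2 A B C D ->
  branch n.+1 (N / (i + r)) (N / (i + l)) c1 c2
    (N * C) (N * D) (i * C + A) (i * D + B).
Proof.
have a_gt0 := a0.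
move=> i0 h1 h2 hT [A0 B0 C0 D0 al lr ra ac c ca ends inv ex].
have den y : a <= y -> 0 < C + D * y.
  by move=> ay; rewrite ltr_pwDl// mulr_ge0//; lra.
have num y : a <= y -> 0 <= A + B * y.
  by move=> ay; apply: addr_ge0 => //; apply: mulr_ge0 => //; lra.
have step y : a <= y -> moebius (N * C) (N * D) (i * C + A) (i * D + B) y =
    N / (i + moebius A B C D y).
  move=> ay; have := den _ ay; have := num _ ay; rewrite /moebius => ny dy.
  have ? : 0 < i * (C + D * y) by rewrite mulr_gt0.
  by field; rewrite !lt0r_neq0//; lra.
have il : 0 < i + l by lra. have ir : 0 < i + r by lra.
split => //.
- exact: mulr_ge0 (ltW N0) (ltW C0).
- exact: mulr_ge0 (ltW N0) D0.
- by rewrite ltr_pwDl// mulr_gt0.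
- by rewrite addr_ge0// mulr_ge0// ltW.
- by rewrite ltr_pM2l// ltf_pV2 ?posrE//; lra.
- rewrite !step//; last by lra.
  by case: ends => -[-> ->]; [right|left].
- move=> x hx; have x0 : 0 < x by case/andP: hx => hx1 _; apply: lt_trans hx1; apply: lt_le_trans h1.
  have Tx := hT _ hx.
  have hTx : l < T x < r.
    rewrite Tx; case/andP: hx; rewrite ltr_pdivrMr// ltr_pdivlMr// => u v.
    by rewrite ltrBrDr ltrBlDr ltr_pdivlMr// ltr_pdivrMr//; apply/andP; split; lra.
  have [h3 h4] := inv _ hTx; rewrite iterSr; split => //.
  rewrite step; last by case/andP: h3 => ? _; lra.
  by rewrite h4 Tx addrC subrK invf_div mulrC divfK// lt0r_neq0.
- rewrite exprSr -mulrA; apply: (le_trans ex).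
  rewrite ler_wpM2l ?exprn_ge0 ?divr_ge0 ?(ltW N0) ?exprn_ge0 ?(ltW a0)//.
  have -> : N / a ^+ 2 * (N / (i + l) - N / (i + r)) =
     (N / (i + l) / a) * (N / (i + r) / a) * (r - l).
    by field; rewrite !lt0r_neq0//.
  rewrite ler_peMl ?subr_ge0 ?(ltW lr)//.
  have h3 : a <= N / (i + l).
    by apply: (le_trans h1); rewrite ler_pM2l// lef_pV2 ?posrE//; lra.
  by rewrite mulr_ege1// ler_pdivlMr ?mul1r.
Qed.

(** Inside [(l, r)], the points that [T ^ n] sends into [(k1, k2)] fill an interval
    whose share of [(l, r)] is comparable to [k2 - k1], uniformly in [n]. *)
Lemma branch_pull n l r c1 c2 A B C D k1 k2 : branch n l r c1 c2 A B C D ->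
  c1 <= k1 -> k1 < k2 -> k2 <= c2 ->
  exists m1 m2, [/\ l <= m1, m1 < m2, m2 <= r,
    (a / (a + 1)) ^+ 2 * (k2 - k1) * (r - l) <= m2 - m1 &
    forall x, m1 < x < m2 -> k1 < iter n T x < k2].
Proof.
have a_gt0 := a0.
move=> [A0 B0 C0 D0 al lr ra ac c ca ends inv ex] ck1 k12 k2c.
have [ak1 ak2 ac2] : [/\ a <= k1, a <= k2 & a <= c2] by split; lra.
have den y : a <= y -> 0 < C + D * y.
  by move=> ay; rewrite ltr_pwDl// mulr_ge0//; lra.
set psi := moebius A B C D in ends inv *.
(* the determinant, whose sign is the orientation of the inverse branch *)
set E := B * C - A * D.
have sub y z : a <= y -> a <= z ->
    psi y - psi z = E * ((y - z) / ((C + D * y) * (C + D * z))).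
  by move=> ay az; rewrite moebiusB ?den// mulrA.
have sub0 y z : a <= z -> z < y -> 0 < (y - z) / ((C + D * y) * (C + D * z)).
  by move=> az zy; rewrite divr_gt0 ?mulr_gt0 ?subr_gt0// den//; lra.
have dist := moebius_distortion a0 A0 B0 C0 D0 ac c ca ck1 k12 k2c.
rewrite -/psi in dist.
have c12 := sub0 _ _ ac c.
case: ends => -[e1 e2]; rewrite e1 e2 in dist.
- have E0 : 0 < E.
    by rewrite -(pmulr_lgt0 _ c12) -sub// e1 e2 subr_gt0.
  have mono y z : a <= z -> a <= y -> (psi z < psi y) = (z < y).
    move=> az ay; rewrite -subr_gt0 sub// -[in RHS]subr_gt0 pmulr_rgt0//.
    by rewrite pmulr_lgt0// invr_gt0 mulr_gt0 ?den.
  exists (psi k1), (psi k2); split => //.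
  + by rewrite -e1 leNgt mono// -leNgt.
  + by rewrite mono.
  + by rewrite -e2 leNgt mono// -leNgt.
  + by move: dist; rewrite !gtr0_norm// subr_gt0 ?mono.
  + move=> x /andP[x1 x2].
    have /inv[/andP[t1 t2] tx] : l < x < r.
      apply/andP; split.
        by apply: le_lt_trans x1; rewrite -e1 leNgt mono// -leNgt.
      by apply: lt_le_trans x2 _; rewrite -e2 leNgt mono// -leNgt.
    move: (iter n T x) t1 t2 tx => y t1 t2 tx.
    have ay := le_trans ac (ltW t1).
    by move: x1 x2; rewrite -tx !mono// => -> ->.
- have E0 : E < 0.
    by rewrite -(pmulr_llt0 _ c12) -sub// e1 e2 subr_lt0.
  have mono y z : a <= z -> a <= y -> (psi z < psi y) = (y < z).
    move=> az ay; rewrite -subr_gt0 sub// -[in RHS]subr_lt0 nmulr_rgt0//.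
    by rewrite pmulr_llt0// invr_gt0 mulr_gt0 ?den.
  exists (psi k2), (psi k1); split => //.
  + by rewrite -e2 leNgt mono// -leNgt.
  + by rewrite mono.
  + by rewrite -e1 leNgt mono// -leNgt.
  + by move: dist; rewrite !ltr0_norm ?opprB// subr_lt0 ?mono.
  + move=> x /andP[x1 x2].
    have /inv[/andP[t1 t2] tx] : l < x < r.
      apply/andP; split.
        by apply: le_lt_trans x1; rewrite -e2 leNgt mono// -leNgt.
      by apply: lt_le_trans x2 _; rewrite -e1 leNgt mono// -leNgt.
    move: (iter n T x) t1 t2 tx => y t1 t2 tx.
    have ay := le_trans ac (ltW t1).
    by move: x1 x2; rewrite -tx !mono// => -> ->.
Qed.
End Branch.

(** * Almost every point expands to a definite size *)

Section Stuck.
Variables (R : realType) (N a d p f g : R) (T : R -> R).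
Hypothesis H : overlapping_map N a d p f g T.

(** Intervals containing [[f, p]] or [[p, g]] have a definite size, and two more
    steps of [T] stretch them over [(f, g)]. *)
Definition contains_half (c1 c2 : R) := (c1 <= f /\ p <= c2) \/ (c1 <= p /\ g <= c2).

Definition expandable (w1 w2 y : R) := exists n l r c1 c2 A B C D,
  branch N a T n l r c1 c2 A B C D /\
  [/\ w1 <= l, r <= w2, l < y < r & contains_half c1 c2].

(** The points of [(w1, w2)] around which no iterate of [T] expands a subinterval
    of [(w1, w2)] to one that contains a half of [[f, g]]. *)
Definition stuck (w1 w2 : R) := [set y | w1 < y < w2 /\ ~ expandable w1 w2 y].

Lemma expandable_sub w1 w2 v1 v2 y : v1 <= w1 -> w2 <= v2 ->
  expandable w1 w2 y -> expandable v1 v2 y.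
Proof.
move=> vw wv [n [l [r [c1 [c2 [A [B [C [D [hb [h1 h2 h3 h4]]]]]]]]]]].
exists n, l, r, c1, c2, A, B, C, D; split => //; split => //; lra.
Qed.

Lemma stuck_half0 w1 w2 : a <= w1 -> w1 < w2 -> w2 <= a + 1 -> contains_half w1 w2 ->
  stuck w1 w2 = set0.
Proof.
move=> aw w12 wa fw; apply/seteqP; split => // y [hy]; apply.
exists 0%N, w1, w2, w1, w2, 0, 1, 1, 0; split; last by split.
exact: branch_id.
Qed.

(** [(w1, w2)] lies on the side of the cut where the digit is [i]. *)
Definition on_branch (i w1 w2 : R) :=
  (i = d /\ a <= w1 /\ w2 <= p) \/ (i = d - 1 /\ p <= w1 /\ w2 <= a + 1).

Lemma on_branch_T i w1 w2 x : on_branch i w1 w2 -> w1 < x < w2 ->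
  T x = N / x - i.
Proof.
move=> ob /andP[x1 x2]; case: ob => -[-> [h1 h2]].
  by rewrite (om_Tleft H)//; apply/andP; split; lra.
by rewrite (om_Tright H)//; apply/andP; split; lra.
Qed.

Lemma on_branch_bounds i w1 w2 : on_branch i w1 w2 -> w1 < w2 ->
  [/\ 1 <= i, a <= w1 & w2 <= a + 1].
Proof.
have ap := a_lt_f H; have fp := f_lt_p H; have pg := p_lt_g H.
have ga := g_lt_a1 H; have d2 := om_d_ge2 H.
by move=> [] [-> [h1 h2]] w12; split; lra.
Qed.

Lemma divN_le x y : 0 < x -> x <= y -> N / y <= N / x.
Proof.
move=> x0 xy; rewrite ler_pM2l ?(N_gt0 H)// lef_pV2 ?posrE//; lra.
Qed.

Lemma divN_lt x y : 0 < x -> x < y -> N / y < N / x.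
Proof.
move=> x0 xy; rewrite ltr_pM2l ?(N_gt0 H)// ltf_pV2 ?posrE//; lra.
Qed.

Lemma divN_cut : N / p = d + a.
Proof. by rewrite -(om_cut H) [p * _]mulrC mulfK// gt_eqF// (p_gt0 H). Qed.
Lemma divN_f : N / f = f + d.
Proof. by rewrite -[in LHS](om_fixf H) [f * _]mulrC mulfK// gt_eqF// (om_f_gt0 H). Qed.
Lemma divN_g : N / g = g + (d - 1).
Proof. by rewrite -[in LHS](om_fixg H) [g * _]mulrC mulfK// gt_eqF// (om_g_gt0 H). Qed.

Lemma on_branch_image i w1 w2 : on_branch i w1 w2 -> w1 < w2 ->
  [/\ a <= N / w2 - i, N / w2 - i < N / w1 - i & N / w1 - i <= a + 1].
Proof.
have a0 := a_gt0 H => ob w12.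
have [i1 aw wa] := on_branch_bounds ob w12.
have p0 := p_gt0 H.
have w1p : 0 < w1 by lra.
have h := divN_lt w1p w12; split; last 2 first.
- by lra.
- case: ob => -[-> [h1 h2]].
    by have := divN_le a0 h1; have := om_left_le H; lra.
  by have := divN_le p0 h1; rewrite divN_cut; lra.
- have w2p : 0 < w2 by lra.
  case: ob => -[-> [h1 h2]].
    by have := divN_le w2p h2; rewrite divN_cut; lra.
  by have := divN_le w2p h2; have := om_right_ge H; lra.
Qed.

(** Prefixing a branch with one step of [T] gives a branch, so an expandable image
    point comes from an expandable point. *)
Lemma stuck_step i w1 w2 x : on_branch i w1 w2 -> w1 < w2 ->
  stuck w1 w2 x -> stuck (N / w2 - i) (N / w1 - i) (T x).
Proof.
have a0 := a_gt0 H; have N0 := N_gt0 H => ob w12 [/[dup] wx /andP[x1 x2] nx].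
have [i1 aw wa] := on_branch_bounds ob w12.
have Tx := on_branch_T ob wx.
have [x0 w10] : 0 < x /\ 0 < w1 by split; lra.
split.
  by rewrite Tx !ltrD2r !divN_lt.
move=> [n [l [r [c1 [c2 [A [B [C [D [hb [h1 h2 /andP[h3 h4] h5]]]]]]]]]]].
apply: nx.
have al := br_al hb; have lr := br_lr hb.
have il : 0 < i + l by lra. have ir : 0 < i + r by lra.
have w20 : 0 < w2 by lra.
have w1r : w1 <= N / (i + r).
  rewrite ler_pdivlMr// mulrC -ler_pdivlMr//; lra.
have w2l : N / (i + l) <= w2.
  rewrite ler_pdivrMr// mulrC -ler_pdivrMr//; lra.
exists n.+1, (N / (i + r)), (N / (i + l)), c1, c2,
  (N * C), (N * D), (i * C + A), (i * D + B); split.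
  apply: branch_cons hb => //; try lra.
  by move=> z /andP[z1 z2]; apply: (on_branch_T ob); apply/andP; split; lra.
split => //; apply/andP; split.
  rewrite ltr_pdivrMr// mulrC -ltr_pdivrMr//; lra.
rewrite ltr_pdivlMr// mulrC -ltr_pdivlMr//; lra.
Qed.

Lemma on_branch_dist i w1 w2 x y : on_branch i w1 w2 -> w1 < x < w2 -> w1 < y < w2 ->
  `|x - y| = x * y / N * `|T x - T y|.
Proof.
have a0 := a_gt0 H; have N0 := N_gt0 H => ob hx hy.
have w12 : w1 < w2 by case/andP: hx => ? ?; lra.
have [i1 aw wa] := on_branch_bounds ob w12.
have x0 : 0 < x by case/andP: hx => ? ?; lra.
have y0 : 0 < y by case/andP: hy => ? ?; lra.
rewrite (on_branch_T ob hx) (on_branch_T ob hy).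
have -> : N / x - i - (N / y - i) = (y - x) / (x * y / N).
  by field; rewrite !lt0r_neq0.
have h0 : 0 < x * y / N by rewrite divr_gt0 ?mulr_gt0.
rewrite normrM normfV (gtr0_norm h0) mulrC mulfVK ?gt_eqF//.
exact: distrC.
Qed.

Lemma stuck_cover_step i w1 w2 t : on_branch i w1 w2 -> w1 < w2 ->
  cover_le (stuck (N / w2 - i) (N / w1 - i)) t -> cover_le (stuck w1 w2) t.
Proof.
have a0 := a_gt0 H; have N0 := N_gt0 H => ob w12 hc.
have [i1 aw wa] := on_branch_bounds ob w12.
rewrite -[t]mul1r; apply: (cover_le_expanding _ _ _ hc) => //.
  by move=> x; exact: stuck_step.
move=> x y [hx _] [hy _]; rewrite (on_branch_dist ob hx hy) ler_wpM2r//.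
rewrite ler_pdivrMr// mul1r; apply: le_trans (om_a1_sqr H); rewrite expr2.
by case/andP: hx => ? ?; case/andP: hy => ? ?; apply: ler_pM; lra.
Qed.

(** Three uncut steps contract a cover by the inverse slope of [T ^ 3]. Bounding the
    product of the three points as a whole, and not factor by factor, matters: on the
    left of the cut it is affine in [x], and its value at [p] is what makes
    [kappaL + kappaR < 1]. *)
Lemma stuck_cover_step3 i j k w1 w2 v1 v2 u1 u2 P t : w1 < w2 ->
  v1 = N / w2 - i -> v2 = N / w1 - i -> u1 = N / v2 - j -> u2 = N / v1 - j ->
  on_branch i w1 w2 -> on_branch j v1 v2 -> on_branch k u1 u2 ->
  (forall x, w1 < x < w2 -> v1 < T x < v2 -> u1 < T (T x) < u2 ->
    x * T x * T (T x) <= P) ->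
  cover_le (stuck (N / u2 - k) (N / u1 - k)) t ->
  cover_le (stuck w1 w2) (P ^+ 2 / N ^+ 3 * t).
Proof.
have a0 := a_gt0 H; have N0 := N_gt0 H.
move=> w12 v1E v2E u1E u2E obw obv obu hP hc.
have [av] := on_branch_image obw w12; rewrite -v1E -v2E in av * => v12 va.
have [au] := on_branch_image obv v12; rewrite -u1E -u2E in au * => u12 ua.
have [i1 aw wa] := on_branch_bounds obw w12.
have b1 x : stuck w1 w2 x -> stuck v1 v2 (T x).
  by move=> /(stuck_step obw w12); rewrite -v1E -v2E.
have b2 x : stuck w1 w2 x -> stuck u1 u2 (T (T x)).
  by move=> /b1/(stuck_step obv v12); rewrite -u1E -u2E.
apply: (@cover_le_expanding _ _ _ (T \o T \o T)) hc.
- by rewrite divr_ge0 ?sqr_ge0// exprn_ge0// ltW.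
- by move=> x /b2/(stuck_step obu u12).
move=> x y bx b_y.
have [[wx _] [wy _]] := (bx, b_y).
have [[vx _] [vy _]] := (b1 _ bx, b1 _ b_y).
have [[ux _] [uy _]] := (b2 _ bx, b2 _ b_y).
rewrite (on_branch_dist obw wx wy) (on_branch_dist obv vx vy) (on_branch_dist obu ux uy) /=.
rewrite !mulrA ler_wpM2r//.
have hPx := hP _ wx vx ux; have hPy := hP _ wy vy uy.
have pos z u v : a <= u -> u < z < v -> 0 < z by move=> ? /andP[? ?]; lra.
have := pos _ _ _ aw wx; have := pos _ _ _ aw wy.
have := pos _ _ _ av vx; have := pos _ _ _ av vy.
have := pos _ _ _ au ux; have := pos _ _ _ au uy.
move: (T (T x)) (T (T y)) hPx hPy => x2 y2; move: (T x) (T y) => x1 y1.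
move=> hPx hPy y20 x20 y10 x10 y0 x0.
have -> : x * y / N * x1 * y1 / N * x2 * y2 / N =
  (x * x1 * x2) * (y * y1 * y2) / N ^+ 3 by field; rewrite gt_eqF.
rewrite ler_pM2r ?invr_gt0 ?exprn_gt0// expr2.
by apply: ler_pM => //; rewrite ltW// !mulr_gt0.
Qed.

Lemma cover_le_set0 t : 0 <= t -> cover_le (set0 : set R) t.
Proof. by move=> t0; exists [::]; split => //; rewrite big_nil. Qed.

(** If the second image of [(w1, p)] still straddles the cut, it contains [[p, g]]
    because [T] sends points near [a] beyond [g], and no point is stuck. Otherwise the
    three steps needed for [kappaL] are uncut. *)
Lemma stuck_cover_left w1 t : 0 <= t ->
  (forall v1 v2, a <= v1 -> v1 < v2 -> v2 <= a + 1 -> cover_le (stuck v1 v2) t) ->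
  f < w1 -> w1 < p -> cover_le (stuck w1 p) (kappaL N a p * t).
Proof.
move=> t0 IH fw wp.
have a0 := a_gt0 H; have N0 := N_gt0 H; have af := a_lt_f H; have fp := f_lt_p H.
have pg := p_lt_g H; have ga := g_lt_a1 H; have d2 := om_d_ge2 H.
have k0 := kappaL_ge0 H.
have obw : on_branch d w1 p by left; split => //; split; lra.
pose v2 := N / w1 - d.
have v1E : a = N / p - d by rewrite divN_cut; lra.
have v2f : v2 <= f.
  have := divN_lt (om_f_gt0 H) fw; rewrite divN_f /v2; lra.
have av2 : a < v2.
  have w10 : 0 < w1 by lra.
  have := divN_lt w10 wp; rewrite divN_cut /v2; lra.
have obv : on_branch d a v2 by left; split => //; split; lra.
have [au u12 ua] := on_branch_image obv av2.
have [u1p|pu1] := ltP (N / v2 - d) p.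
  have e : stuck (N / v2 - d) (N / a - d) = set0.
    by apply: stuck_half0 => //; right; split; [exact: ltW|exact: om_left_ge H].
  rewrite (_ : stuck w1 p = set0); first by apply: cover_le_set0; rewrite mulr_ge0.
  apply/seteqP; split => // x /(stuck_step obw wp); rewrite -v1E -/v2.
  by move=> /(stuck_step obv av2); rewrite e.
have obu : on_branch (d - 1) (N / v2 - d) (N / a - d).
  by right; split => //; split.
have [az z12 za] := on_branch_image obu u12.
apply: (stuck_cover_step3 wp v1E erefl erefl erefl obw obv obu); last exact: IH.
move=> x hx hv _.
have Tx0 : 0 < N / x - d.
  by rewrite -(on_branch_T obw hx); case/andP: hv => y1 _; exact: lt_trans a0 y1.
rewrite (on_branch_T obv hv) (on_branch_T obw hx).
case/andP: hx => x1 x2.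
have x0 : 0 < x by lra.
(* affine and increasing in x, hence largest at the cut *)
have -> : x * (N / x - d) * (N / (N / x - d) - d) = (N + d ^+ 2) * x - d * N.
  have e : N - d * x = x * (N / x - d) by field; rewrite gt_eqF.
  have e0 : N - d * x != 0 by rewrite e gt_eqF// mulr_gt0.
  by field; rewrite mulNr e0 gt_eqF.
have hp := om_cut H; have hl := left_image_le H.
have : (N + d ^+ 2) * x <= (N + d ^+ 2) * p.
  by apply: ler_wpM2l (ltW x2); apply: addr_ge0; rewrite ?sqr_ge0// ltW.
have : p * N <= p * (a * (a + 1 + d)) by rewrite ler_pM2l// (p_gt0 H).
have : d * (p * (d + a)) = d * N by rewrite hp.
by nra.
Qed.

(** Mirror image of [stuck_cover_left]: near [a + 1], [T] takes values below [f]. *)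
Lemma stuck_cover_right w2 t : 0 <= t ->
  (forall v1 v2, a <= v1 -> v1 < v2 -> v2 <= a + 1 -> cover_le (stuck v1 v2) t) ->
  p < w2 -> w2 < g -> cover_le (stuck p w2) (kappaR N a p g * t).
Proof.
move=> t0 IH pw wg.
have a0 := a_gt0 H; have N0 := N_gt0 H; have af := a_lt_f H; have fp := f_lt_p H.
have pg := p_lt_g H; have ga := g_lt_a1 H; have d2 := om_d_ge2 H.
have k0 := kappaR_ge0 H.
have obw : on_branch (d - 1) p w2 by right; split => //; split; lra.
pose v1 := N / w2 - (d - 1).
have v2E : a + 1 = N / p - (d - 1) by rewrite divN_cut; lra.
have v1g : g <= v1.
  have w20 : 0 < w2 by lra.
  have := divN_lt w20 wg; rewrite divN_g /v1; lra.
have v1a : v1 < a + 1.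
  have := divN_lt (p_gt0 H) pw; rewrite divN_cut /v1; lra.
have obv : on_branch (d - 1) v1 (a + 1) by right; split => //; split; lra.
have [au u12 ua] := on_branch_image obv v1a.
have [pu2|u2p] := ltP p (N / v1 - (d - 1)).
  have e : stuck (N / (a + 1) - (d - 1)) (N / v1 - (d - 1)) = set0.
    by apply: stuck_half0 => //; left; split; [exact: om_right_le H|exact: ltW].
  rewrite (_ : stuck p w2 = set0); first by apply: cover_le_set0; rewrite mulr_ge0.
  apply/seteqP; split => // x /(stuck_step obw pw); rewrite -v2E -/v1.
  by move=> /(stuck_step obv v1a); rewrite e.
have obu : on_branch d (N / (a + 1) - (d - 1)) (N / v1 - (d - 1)).
  by left; split => //; split.
have [az z12 za] := on_branch_image obu u12.
apply: (stuck_cover_step3 pw erefl v2E erefl erefl obw obv obu); last exact: IH.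
move=> x /andP[x1 x2] /andP[y1 y2] /andP[z1 z2].
have x0 : 0 <= x := ltW (lt_trans (p_gt0 H) x1).
have y0 : 0 <= T x := ltW (lt_trans (lt_le_trans (om_g_gt0 H) v1g) y1).
have z0 : 0 <= T (T x) := ltW (lt_trans (lt_le_trans a0 au) z1).
apply: ler_pM (le_trans (ltW z2) u2p) => //; first exact: mulr_ge0.
exact: ler_pM (ltW (lt_trans x2 wg)) (ltW y2).
Qed.

(** An interval around [p] that contains no half of [[f, g]] lies inside [(f, g)],
    so that both one-sided estimates apply to its two parts. *)
Lemma stuck_cover_cut w1 w2 t : 0 <= t ->
  (forall v1 v2, a <= v1 -> v1 < v2 -> v2 <= a + 1 -> cover_le (stuck v1 v2) t) ->
  a <= w1 -> w1 < p -> p < w2 -> w2 <= a + 1 ->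
  cover_le (stuck w1 w2) ((kappaL N a p + kappaR N a p g) * t).
Proof.
move=> t0 IH aw wp pw wa.
have kL := kappaL_ge0 H; have kR := kappaR_ge0 H.
have [fw|wf] := ltP f w1; last first.
  rewrite stuck_half0//; [|lra|by left; split => //; lra].
  by apply: cover_le_set0; rewrite mulr_ge0 ?addr_ge0.
have [wg|gw] := ltP w2 g; last first.
  rewrite stuck_half0//; [|lra|by right; split => //; lra].
  by apply: cover_le_set0; rewrite mulr_ge0 ?addr_ge0.
have cL := stuck_cover_left t0 IH fw wp.
have cR := stuck_cover_right t0 IH pw wg.
have c0 : cover_le [set x | p <= x <= p] 0 by apply: cover_le_itv; lra.
rewrite mulrDl -[X in cover_le _ (_ + X)]addr0.
apply: cover_le_sub (cover_leU cL (cover_leU cR c0)) => x [/andP[x1 x2] nx].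
have [xp|px|->] := ltgtP x p; [left|right; left|by right; right => /=; rewrite lexx].
- split; first by rewrite x1.
  by move=> gx; apply: nx; apply: expandable_sub gx; lra.
- split; first by rewrite px.
  by move=> gx; apply: nx; apply: expandable_sub gx; lra.
Qed.

(** Inverse of a lower bound for the slope of [T ^ 2]. A single step may have slope
    [1] at [a + 1], but [x * T x = N - i * x <= N - a]. *)
Definition contraction := ((N - a) / N) ^+ 2.

Lemma contraction_itv : 0 <= contraction /\ contraction < 1.
Proof.
have a0 := a_gt0 H; have N0 := N_gt0 H.
have aN : a <= N by have := om_a1_sqr H; nra.
have z0 : 0 <= (N - a) / N by apply: divr_ge0; lra.
have z1 : (N - a) / N < 1 by rewrite ltr_pdivrMr//; lra.
by rewrite /contraction sqr_ge0; split => //; rewrite expr_lt1.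
Qed.

Lemma two_step_growth i j w1 w2 v1 v2 : w1 < w2 ->
  v1 = N / w2 - i -> v2 = N / w1 - i ->
  on_branch i w1 w2 -> on_branch j v1 v2 ->
  w2 - w1 <= contraction * ((N / v1 - j) - (N / v2 - j)).
Proof.
have a0 := a_gt0 H; have N0 := N_gt0 H.
move=> w12 v1E v2E obw obv.
have [av v12 va] := on_branch_image obw w12; rewrite -v1E -v2E in av v12 va.
have [i1 aw wa] := on_branch_bounds obw w12.
have aN : a <= N by have := om_a1_sqr H; nra.
have [w10 w20 v10 v20] : [/\ 0 < w1, 0 < w2, 0 < v1 & 0 < v2] by split; lra.
have e1 : w2 * v1 = N - i * w2 by rewrite v1E; field; rewrite gt_eqF.
have e2 : w1 * v2 = N - i * w1 by rewrite v2E; field; rewrite gt_eqF.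
have d1 : v2 - v1 = N * (w2 - w1) / (w1 * w2).
  by rewrite v1E v2E; field; rewrite !gt_eqF.
have -> : N / v1 - j - (N / v2 - j) = N * (v2 - v1) / (v1 * v2).
  by field; rewrite !gt_eqF.
rewrite d1 /contraction.
have -> : ((N - a) / N) ^+ 2 * (N * (N * (w2 - w1) / (w1 * w2)) / (v1 * v2)) =
   (N - a) ^+ 2 * (w2 - w1) / ((w2 * v1) * (w1 * v2)).
  by field; rewrite !gt_eqF.
rewrite ler_pdivlMr ?mulr_gt0// mulrC ler_pM2r ?subr_gt0// expr2.
have b1 : w2 * v1 <= N - a by rewrite e1; nra.
have b2 : w1 * v2 <= N - a by rewrite e2; nra.
by apply: ler_pM => //; apply: mulr_ge0; exact: ltW.
Qed.

(** An interval off the cut is mapped without loss by one branch. It grows by a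
    definite factor every two steps inside an interval of length [1], so it meets the cut
    after finitely many steps. *)
Lemma stuck_cover_of_cut (P : R) :
  0 <= P ->
  (forall w1 w2, a <= w1 -> w1 < p -> p < w2 -> w2 <= a + 1 ->
     cover_le (stuck w1 w2) P) ->
  forall w1 w2, a <= w1 -> w1 < w2 -> w2 <= a + 1 -> cover_le (stuck w1 w2) P.
Proof.
move=> P0 hcut w1 w2 aw w12 wa.
have a0 := a_gt0 H; have [z0 z1] := contraction_itv.
have w0 : 0 < w2 - w1 by rewrite subr_gt0.
have [k hk] := expr_lt_eps z0 z1 w0.
elim: k w1 w2 aw w12 wa w0 hk => [|k IH] w1 w2 aw w12 wa w0.
  by rewrite expr0; lra.
have side v1 v2 : a <= v1 -> v1 < v2 -> v2 <= a + 1 -> ~ (v1 < p < v2) ->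
    exists i, on_branch i v1 v2.
  move=> h1 h2 h3 h4; have [v2p|pv2] := leP v2 p; first by exists d; left.
  exists (d - 1); right; split => //; split => //; rewrite leNgt; apply/negP => h5.
  by apply: h4; rewrite h5.
have [/andP[wp pw] _|nw] := pselect (w1 < p < w2); first exact: hcut.
have [i obw] := side _ _ aw w12 wa nw.
have [av v12 va] := on_branch_image obw w12 => hk.
apply: (stuck_cover_step obw w12).
have [/andP[vp pv]|nv] := pselect (N / w2 - i < p < N / w1 - i); first exact: hcut.
have [j obv] := side _ _ av v12 va nv.
have [au u12 ua] := on_branch_image obv v12.
apply: (stuck_cover_step obv v12).
have growth := two_step_growth w12 erefl erefl obw obv.
apply: IH => //; first by rewrite subr_gt0.
have [z_eq0|znz] := eqVneq contraction 0.
  by move: growth; rewrite z_eq0 mul0r; lra.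
have zp : 0 < contraction by rewrite lt0r znz.
by rewrite -(ltr_pM2l zp) -exprS; apply: (lt_le_trans hk).
Qed.

(** Each passage through the cut multiplies the bound by [kappaL + kappaR < 1]. *)
Lemma stuck_cover m w1 w2 : a <= w1 -> w1 < w2 -> w2 <= a + 1 ->
  cover_le (stuck w1 w2) ((kappaL N a p + kappaR N a p g) ^+ m).
Proof.
have k0 := addr_ge0 (kappaL_ge0 H) (kappaR_ge0 H).
elim: m w1 w2 => [|m IH] w1 w2 aw w12 wa.
  apply: (@cover_le_sub _ _ [set x | w1 <= x <= w2]).
    by move=> x [/andP[x1 x2] _] /=; rewrite !ltW.
  by rewrite expr0; apply: cover_le_itv; lra.
apply: stuck_cover_of_cut => //; first by rewrite exprn_ge0.
move=> v1 v2 av vp pv va; rewrite exprS; apply: stuck_cover_cut => //.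
by rewrite exprn_ge0.
Qed.

Lemma stuck_negligible w1 w2 : a <= w1 -> w1 < w2 -> w2 <= a + 1 ->
  (@lebesgue_measure R).-negligible (stuck w1 w2).
Proof.
move=> aw w12 wa; apply: cover_le_negligible => t t0.
have k0 := addr_ge0 (kappaL_ge0 H) (kappaR_ge0 H).
have [m hm] := expr_lt_eps k0 (kappa_sum_lt1 H) t0.
have [s [h1 h2 h3]] := stuck_cover m aw w12 wa.
by exists s; split => //; apply: le_trans (ltW hm).
Qed.
End Stuck.

(** * Porous sets *)

(** At a density point of [C] the holes of proportion [c] cannot occur at arbitrarily
    small scales: a hole [(m1, m2)] near [x] at scale [r - l] bounds the density of [C] in
    the ball of that radius by [1 - c / 2]. *)
Lemma porous_negligible (R : realType) (C Z : set R) (c : R) :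
  measurable C -> 0 < c -> (@lebesgue_measure R).-negligible Z ->
  (forall x e : R, C x -> ~ Z x -> 0 < e -> exists l r m1 m2 : R,
    [/\ l < x < r, r - l < e, l <= m1, m1 < m2 & m2 <= r] /\
    c * (r - l) <= m2 - m1 /\ (forall y, m1 < y < m2 -> ~ C y)) ->
  (@lebesgue_measure R).-negligible C.
Proof.
move=> mC c0 hZ hC; pose mu := @lebesgue_measure R.
have [D [mD D0 Dsub]] := lebesgue_density mC.
apply: (@negligibleS _ _ _ mu (D `|` Z)); last first.
  by apply: negligibleU => //; exists D; split.
move=> x Cx; have [Zx|nZx] := pselect (Z x); [by right|left].
apply: Dsub => /= dens.
rewrite indicE mem_set //= in dens.
have /dens : nbhs (1%:E : \bar R) [set y | ((1 - c / 2)%:E < y)%E].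
  by apply: open_ereal_gt'; rewrite lte_fin; lra.
move=> /= [e /= e0 he].
have [l [r [m1 [m2 [[/andP[lx xr] re lm m12 mr] [hc hm]]]]]] := hC _ _ Cx nZx e0.
have mB s : measurable (ball x s) by rewrite ball_itv; exact: measurable_itv.
set rho := r - l in re hc; have rho0 : 0 < rho by rewrite /rho; lra.
have /= := he rho; rewrite sub0r normrN gtr0_norm// => /(_ re rho0).
rewrite lebesgue_measure_ball ?ltW// inver mulrn_eq0/= gt_eqF//.
apply/negP; rewrite -leNgt.
have mm : mu `]m1, m2[%classic = (m2 - m1)%:E.
  by rewrite /mu lebesgue_measure_itv/= lte_fin m12.
have mCB : measurable (C `&` ball x rho) by apply: measurableI => //.
have le1 : (mu (C `&` ball x rho) + (m2 - m1)%:E <= (rho *+ 2)%:E)%E.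
  rewrite -mm -measureU//; last first.
    apply/seteqP; split => // y [[Cy _]] /=; rewrite in_itv/= => hy.
    by have := hm _ hy.
  rewrite -(@lebesgue_measure_ball _ x _ (ltW rho0)); apply: le_measure; rewrite ?inE.
  - by apply: measurableU.
  - exact: mB.
  - move=> y [[]//|/=]; rewrite in_itv/= ball_itv /= in_itv/= => /andP[y1 y2].
    by rewrite /rho; apply/andP; split; lra.
have le2 : (mu (C `&` ball x rho) <= (rho *+ 2 - (m2 - m1))%:E)%E.
  by rewrite EFinB leeBrDr.
apply: (@le_trans _ _ ((rho *+ 2 - (m2 - m1))%:E * ((rho *+ 2)^-1)%:E)%E).
  by rewrite lee_wpmul2r// lee_fin invr_ge0 mulrn_wge0// ltW.
rewrite -EFinM lee_fin -mulr_natr ler_pdivrMr ?pmulrn_lgt0//.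
lra.
Qed.

(** * Orbits from the cut to a given interval *)

Section Reaching.
Variables (R : realType) (N a d p f g : R) (T : R -> R).
Hypothesis H : overlapping_map N a d p f g T.
Variables (u v : R).

Definition reaches k1 k2 := k1 < k2 /\
  exists j, forall x, k1 < x < k2 -> u < iter j T x < v.

Lemma reaches_pull i k1 k2 : 0 < i + k1 ->
  on_branch a d p i (N / (i + k2)) (N / (i + k1)) -> reaches k1 k2 ->
  reaches (N / (i + k2)) (N / (i + k1)).
Proof.
have a0 := a_gt0 H; have N0 := N_gt0 H => ik1 ob [k12 [j hj]].
have lt : N / (i + k2) < N / (i + k1).
  by apply: (divN_lt H) => //; lra.
split => //; exists j.+1 => x hx; rewrite iterSr; apply: hj.
rewrite (on_branch_T H ob hx); case/andP: hx => x1 x2.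
have [i1 h1 h2] := on_branch_bounds H ob lt.
have x0 : 0 < x by lra.
move: x1 x2; rewrite ltr_pdivrMr ?ltr_pdivlMr//; last by lra.
move=> x1 x2; rewrite ltrBrDr ltrBlDr ltr_pdivlMr// ltr_pdivrMr//.
by apply/andP; split; lra.
Qed.

Definition reaches_within s t := exists k1 k2, [/\ s <= k1, k2 <= t & reaches k1 k2].

Lemma reaches_within_pull i s t s' t' : 0 < i + s -> on_branch a d p i s' t' ->
  s' <= N / (i + t) -> N / (i + s) <= t' ->
  reaches_within s t -> reaches_within s' t'.
Proof.
move=> is0 ob hs ht [k1 [k2 [sk kt hk]]]; have k12 := hk.1.
have h1 : s' <= N / (i + k2).
  by apply: (le_trans hs); apply: (divN_le H); lra.
have h2 : N / (i + k1) <= t'.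
  by apply: le_trans ht; apply: (divN_le H); lra.
exists (N / (i + k2)), (N / (i + k1)); split => //.
apply: reaches_pull => //; first by lra.
by case: ob h1 h2 => -[-> [? ?]] ? ?; [left|right]; split => //; split; lra.
Qed.

Lemma reaches_withinS s t s' t' : s' <= s -> t <= t' ->
  reaches_within s t -> reaches_within s' t'.
Proof. by move=> ss tt [k1 [k2 [sk kt hk]]]; exists k1, k2; split => //;
  [exact: le_trans sk|exact: le_trans tt]. Qed.

Lemma divN_df : N / (d + f) = f.
Proof.
have d2 := om_d_ge2 H; have f0 := om_f_gt0 H.
by rewrite -[X in X / _](om_fixf H) [f + d]addrC mulfK// gt_eqF//; lra.
Qed.
Lemma divN_eg : N / (d - 1 + g) = g.
Proof.
have d2 := om_d_ge2 H; have g0 := om_g_gt0 H.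
by rewrite -[X in X / _](om_fixg H) [g + _]addrC mulfK// gt_eqF//; lra.
Qed.
Lemma divN_da : N / (d + a) = p.
Proof.
have d2 := om_d_ge2 H; have a0 := a_gt0 H.
by rewrite -[X in X / _](om_cut H) mulfK// gt_eqF//; lra.
Qed.

(** The left branch maps [(f, p)] onto [(a, f)]. *)
Lemma reaches_left : reaches_within a f -> reaches_within f p.
Proof.
have a0 := a_gt0 H; have af := a_lt_f H; have d2 := om_d_ge2 H.
apply: (@reaches_within_pull d).
- by lra.
- by left; split => //; split; lra.
- by rewrite divN_df.
- by rewrite divN_da.
Qed.

(** The right branch maps [(p, g)] onto [(g, a + 1)]. *)
Lemma reaches_right : reaches_within g (a + 1) -> reaches_within p g.
Proof.
have a0 := a_gt0 H; have g0 := om_g_gt0 H; have ga := g_lt_a1 H; have d2 := om_d_ge2 H.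
apply: (@reaches_within_pull (d - 1)).
- by lra.
- by right; split => //; split; lra.
- by rewrite (_ : d - 1 + (a + 1) = d + a) ?divN_da//; lra.
- by rewrite divN_eg.
Qed.

Lemma reaches_within_overlap : a <= u -> u < v -> v <= a + 1 ->
  reaches_within f g.
Proof.
have a0 := a_gt0 H; have N0 := N_gt0 H; have af := a_lt_f H; have fp := f_lt_p H.
have pg := p_lt_g H; have ga := g_lt_a1 H; have d2 := om_d_ge2 H.
move=> au uv va.
have here k1 k2 s t : u <= k1 -> k1 < k2 -> k2 <= v -> s <= k1 -> k2 <= t ->
    reaches_within s t.
  move=> h1 h2 h3 h4 h5; exists k1, k2; split => //; split => //.
  by exists 0%N => x /andP[x1 x2] /=; apply/andP; split; lra.
have [uf|fu] := ltP u f; last have [ug|gu] := ltP u g.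
- apply: (@reaches_withinS f p); [by []|lra|].
  apply: reaches_left.
  apply: (here u (Num.min v f)); rewrite ?lt_min ?ge_min ?uv ?lexx ?orbT//.
- apply: (here u (Num.min v g)); rewrite ?lt_min ?ge_min ?uv ?lexx ?orbT//.
- apply: (@reaches_withinS p g); [lra|by []|].
  by apply: reaches_right; exact: (here u v).
Qed.

(** Both [(f, p)] and [(p, g)] can be steered into any target: the left branch sends
    part of [(a, f)], and the right branch part of [(g, a + 1)], onto [(f, g)]. This is where
    the overlap hypotheses give the bounds [a] and [a + 1] on the pulled-back intervals. *)
Lemma reaches_within_cut : a <= u -> u < v -> v <= a + 1 ->
  reaches_within f p /\ reaches_within p g.
Proof.
have a0 := a_gt0 H; have N0 := N_gt0 H; have af := a_lt_f H; have fp := f_lt_p H.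
have pg := p_lt_g H; have ga := g_lt_a1 H; have d2 := om_d_ge2 H.
move=> au uv va; have fg := reaches_within_overlap au uv va; split.
  apply: reaches_left; apply: (@reaches_within_pull d f g) => //; first by lra.
  - by left; split => //; split; lra.
  - have h := left_image_ge H; rewrite ler_pdivlMr; last by lra.
    by rewrite [d + g]addrC.
  - by rewrite divN_df.
apply: reaches_right; apply: (@reaches_within_pull (d - 1) f g) => //; first by lra.
- by right; split => //; split; lra.
- by rewrite divN_eg.
- have h := right_image_le H; rewrite ler_pdivrMr; last by lra.
  by apply: (le_trans h); rewrite [f + _]addrC.
Qed.
End Reaching.

(** * Infinitely many visits to every interval *)

Section Recurrence.
Variables (R : realType) (N a d p f g : R) (T : R -> R).
Hypothesis H : overlapping_map N a d p f g T.
Variables (u v : R).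
Hypotheses (au : a <= u) (uv : u < v) (va : v <= a + 1).

Definition visits (n0 : nat) := [set x | exists n, (n0 <= n)%N /\ u < iter n T x < v].

(** Once an iterate covers a half of [[f, g]], a fixed proportion of the small
    interval goes on into [(u, v)], by bounded distortion. Starting from a
    sufficiently short interval, the expansion takes at least [n0] steps. *)
Lemma expandable_visits n0 : exists c eta : R, [/\ 0 < c, 0 < eta &
  forall w1 w2 y, w2 - w1 < eta -> expandable N a p f g T w1 w2 y ->
  exists l r m1 m2 : R, [/\ w1 <= l, l < y < r, r <= w2 &
    [/\ l <= m1, m1 < m2, m2 <= r, c * (r - l) <= m2 - m1 &
     forall x, m1 < x < m2 -> visits n0 x]]].
Proof.
have a0 := a_gt0 H; have N0 := N_gt0 H; have fp := f_lt_p H; have pg := p_lt_g H.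
have [[k1 [k2 [fk1 k2p [k12 [j hj]]]]] [k1' [k2' [pk1 k2g [k12' [j' hj']]]]]] :=
  reaches_within_cut H au uv va.
pose L := (N / a ^+ 2) ^+ n0.
have L1 : 1 <= N / a ^+ 2.
  rewrite ler_pdivlMr ?exprn_gt0// mul1r; apply: le_trans (om_a1_sqr H).
  by rewrite lerXn2r// ?nnegrE; lra.
have L0 : 0 < L by rewrite exprn_gt0//; lra.
pose kap := (a / (a + 1)) ^+ 2.
have kap0 : 0 < kap by rewrite exprn_gt0// divr_gt0//; lra.
pose s := Num.min (k2 - k1) (k2' - k1').
have s0 : 0 < s by rewrite lt_min !subr_gt0 k12.
have [s1 s2] : s <= k2 - k1 /\ s <= k2' - k1' by rewrite !ge_min !lexx orbT.
pose t := Num.min (p - f) (g - p).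
have t0 : 0 < t by rewrite lt_min !subr_gt0 fp.
have [t1 t2] : t <= p - f /\ t <= g - p by rewrite !ge_min !lexx orbT.
exists (kap * s), (t / L); split; [exact: mulr_gt0|exact: divr_gt0|].
move=> w1 w2 y hw [n [l [r [c1 [c2 [A [B [C [D [hb [wl rw hy fu]]]]]]]]]]].
have lr := br_lr hb.
have tc : t <= c2 - c1.
  by case: fu => -[c1f c2p]; [apply: le_trans t1 _|apply: le_trans t2 _]; exact: lerB.
have nn : (n0 <= n)%N.
  rewrite leqNgt; apply/negP => nlt.
  suff : c2 - c1 < t by rewrite ltNge tc.
  apply: (le_lt_trans (br_exp hb)).
  apply: (@le_lt_trans _ _ (L * (r - l))).
    by rewrite ler_pM2r ?subr_gt0// /L ler_weXn2l// ltnW.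
  by rewrite mulrC -ltr_pdivlMr//; apply: le_lt_trans hw; exact: lerB.
have fin j0 q1 q2 : c1 <= q1 -> q1 < q2 -> q2 <= c2 -> s <= q2 - q1 ->
    (forall x, q1 < x < q2 -> u < iter j0 T x < v) ->
  exists l r m1 m2 : R, [/\ w1 <= l, l < y < r, r <= w2 &
    [/\ l <= m1, m1 < m2, m2 <= r, kap * s * (r - l) <= m2 - m1 &
     forall x, m1 < x < m2 -> visits n0 x]].
  move=> cq q12 qc sq hq.
  have [m1 [m2 [lm m12 mr hm hx]]] := branch_pull a0 hb cq q12 qc.
  exists l, r, m1, m2; split => //; split => //.
    by apply: le_trans hm; rewrite ler_pM2r ?subr_gt0// ler_pM2l.
  move=> x /hx/hq hxv; exists (j0 + n)%N; split; last by rewrite iterD.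
  by rewrite (leq_trans nn)// leq_addl.
case: fu => -[h1 h2].
  by apply: (fin j k1 k2) => //; [exact: le_trans fk1|exact: le_trans h2].
by apply: (fin j' k1' k2') => //; [exact: le_trans pk1|exact: le_trans h2].
Qed.

(** Rational end points make the exceptional set a countable union. *)
Definition stuck_rat (k : nat) : set R :=
  if @unpickle (rat * rat)%type k is Some q then
    if [&& a <= ratr q.1, (ratr q.1 : R) < ratr q.2 & ratr q.2 <= a + 1]
    then stuck N a p f g T (ratr q.1) (ratr q.2) else set0
  else set0.

Lemma stuck_rat_pickle (q : rat * rat) x :
  [&& a <= ratr q.1, (ratr q.1 : R) < ratr q.2 & ratr q.2 <= a + 1] ->
  stuck N a p f g T (ratr q.1) (ratr q.2) x -> (\bigcup_k stuck_rat k) x.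
Proof.
by move=> qv bx; exists (pickle q); [exact: Logic.I|rewrite /stuck_rat pickleK qv].
Qed.

Lemma stuck_rat_negligible : (@lebesgue_measure R).-negligible (\bigcup_k stuck_rat k).
Proof.
apply: negligible_bigcup => k; rewrite /stuck_rat.
case: unpickle => [q|]; last exact: negligible_set0.
case: ifP => [/and3P[h1 h2 h3]|_]; last exact: negligible_set0.
exact: (stuck_negligible H).
Qed.

(** Passing to the interior yields a measurable set and loses nothing: the holes found
    by [expandable_visits] are open intervals, so they lie in it. *)
Lemma not_visits_negligible n0 : (@lebesgue_measure R).-negligible
  (`]a, a + 1[%classic `\` interior (visits n0)).
Proof.
have [c [eta [c0 eta0 hit]]] := expandable_visits n0.
apply: (porous_negligible _ c0 stuck_rat_negligible).
  apply: measurableD; first exact: measurable_itv.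
  by apply: measurable_realfun.open_measurable; exact: open_interior.
move=> x e [/= + _] nZ e0; rewrite in_itv/= => /andP[ax xa].
pose z := Num.min e eta / 2.
have [z0 ze zeta] : [/\ 0 < z, z + z <= e & z + z <= eta].
  have : 0 < Num.min e eta by rewrite lt_min e0.
  have : Num.min e eta <= e by rewrite ge_min lexx.
  have : Num.min e eta <= eta by rewrite ge_min lexx orbT.
  by rewrite /z => *; split; lra.
have /rat_in_itvoo[q1] : Num.max a (x - z) < x by rewrite gt_max ax; lra.
have /rat_in_itvoo[q2] : x < Num.min (a + 1) (x + z) by rewrite lt_min xa; lra.
rewrite !in_itv/= lt_min gt_max => /andP[xq2 /andP[q2a q2z]] /andP[/andP[aq1 zq1] q1x].
have gx : expandable N a p f g T (ratr q1) (ratr q2) x.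
  apply: contrapT => ng; apply: nZ.
  have qv : [&& a <= ratr q1, (ratr q1 : R) < ratr q2 & ratr q2 <= a + 1].
    by rewrite !ltW//= (lt_trans q1x xq2).
  have bx : stuck N a p f g T (ratr q1) (ratr q2) x by split => //; rewrite q1x.
  exact: (@stuck_rat_pickle (q1, q2) _ qv bx).
have qq : ratr q2 - ratr q1 < eta by lra.
have [l [r [m1 [m2 [wl lyr rw [lm m12 mr hc hm]]]]]] := hit _ _ _ qq gx.
exists l, r, m1, m2; split; first by split => //; lra.
split => // y hy [_]; apply.
apply: (@filterS _ _ _ `]m1, m2[%classic) => [w|]; last by apply: near_in_itvoo; rewrite in_itv.
by rewrite /= in_itv/= => /hm.
Qed.

Lemma ae_visits_infinitely_often : (@lebesgue_measure R).-negligible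
  (`]a, a + 1[%classic `\` \bigcap_n0 visits n0).
Proof.
apply: negligibleS (negligible_bigcup not_visits_negligible) => x [xa nv].
apply: contrapT => nu; apply: nv => n0 _; apply: contrapT => nx; apply: nu.
by exists n0 => //; split => // /interior_subset.
Qed.
End Recurrence.

(** * The expansion map with two digits *)

Lemma fixed_point_gt0 (R : realType) (N : nat) (i : int) : (0 < N)%N ->
  0 < fixed_point N i :> R.
Proof.
move=> N0; rewrite /fixed_point divr_gt0// subr_gt0.
apply: (le_lt_trans (ler_norm _)); rewrite -sqrtr_sqr ltr_sqrt.
  by rewrite ltrDr mulr_gt0// ltr0n.
by rewrite ltr_wpDr ?sqr_ge0// mulr_gt0// ltr0n.
Qed.

Lemma fixed_pointE (R : realType) (N : nat) (i : int) :
  fixed_point N i * (fixed_point N i + i%:~R) = N%:R :> R.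
Proof.
rewrite /fixed_point; set s := Num.sqrt _.
have s2 : s ^+ 2 = 4 * N%:R + i%:~R ^+ 2.
  by rewrite sqr_sqrtr// addr_ge0 ?sqr_ge0// mulr_ge0.
have -> : (s - i%:~R) / 2 * ((s - i%:~R) / 2 + i%:~R) = (s ^+ 2 - i%:~R ^+ 2) / 4.
  by field.
by rewrite s2; field.
Qed.

(** [alpha + 1 <= Num.sqrt N] forces the smaller digit to be at least [1]. At [alpha] the
    digit convention gives [N / alpha - alpha - d] in [[0, 1]], both ends included. *)
Lemma overlapping_expansion_map (R : realType) (N : nat) (alpha : R) (d : int) :
  (2 <= N)%N -> 0 < alpha -> alpha <= Num.sqrt N%:R - 1 ->
  d = digit N alpha alpha -> d - 1 = digit N alpha (alpha + 1) ->
  domain alpha = cylinder N alpha d `|` cylinder N alpha (d - 1) ->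
  fixed_point N (d - 1) <= expansion_map N alpha alpha ->
  expansion_map N alpha (alpha + 1) <= fixed_point N d ->
  overlapping_map N%:R alpha d%:~R (N%:R / (d%:~R + alpha))
    (fixed_point N d) (fixed_point N (d - 1)) (expansion_map N alpha).
Proof.
move=> N2 a0 aN hd hd1 hcyl hl hr.
have N0 : (0 < N)%N by rewrite (leq_trans _ N2).
have NR0 : 0 < N%:R :> R by rewrite ltr0n.
have a1N : (alpha + 1) ^+ 2 <= N%:R.
  by rewrite -[leRHS](@sqr_sqrtr _ N%:R) ?ler0n// lerXn2r// ?nnegrE ?sqrtr_ge0//; lra.
have dB : (d - 1)%:~R = d%:~R - 1 :> R by rewrite intrD.
have dD : (d + 1)%:~R = d%:~R + 1 :> R by rewrite intrD.
have digitE x : x != alpha -> digit N alpha x = Num.floor (N%:R / x - alpha).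
  by move=> xa; rewrite /digit (negbTE xa).
have d1E : d - 1 = Num.floor (N%:R / (alpha + 1) - alpha).
  by rewrite hd1 digitE// gt_eqF//= ltrDl.
have e1 : 1 <= (d - 1)%:~R :> R.
  rewrite ler1z d1E floor_ge_int lerBrDr ler_pdivlMr; last by lra.
  by rewrite [1%:~R + _]addrC -expr2.
have er : (d - 1)%:~R <= N%:R / (alpha + 1) - alpha by rewrite d1E floor_le.
have er' : N%:R / (alpha + 1) - alpha < d%:~R.
  by have := floorD1_gt (N%:R / (alpha + 1) - alpha); rewrite -d1E subrK.
have [dl dr] : d%:~R <= N%:R / alpha - alpha /\ N%:R / alpha - alpha <= d%:~R + 1.
  rewrite -dD hd /digit eqxx /=; case: ifPn => [hi|_].
    rewrite subrK floorK// lexx; split => //.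
    by rewrite -[leRHS]floorK// ler_int lerBlDr lerDl.
  by rewrite floor_le ltW// floorD1_gt.
rewrite dB in e1 er.
have da0 : 0 < d%:~R + alpha by lra.
pose p := N%:R / (d%:~R + alpha).
have pa1 : p < alpha + 1.
  by rewrite ltr_pdivrMr// mulrC -ltr_pdivrMr; lra.
have ap : alpha <= p.
  by rewrite ler_pdivlMr// mulrC -ler_pdivlMr//; lra.
have TaE : expansion_map N alpha alpha = N%:R / alpha - d%:~R.
  by rewrite /expansion_map -hd.
have Ta1E : expansion_map N alpha (alpha + 1) = N%:R / (alpha + 1) - (d%:~R - 1).
  by rewrite /expansion_map -hd1 dB.
rewrite TaE in hl; rewrite Ta1E in hr.
have digits x : alpha < x < alpha + 1 ->
    let y := N%:R / x - alpha in
    expansion_map N alpha x = N%:R / x - d%:~R /\ d%:~R <= y \/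
    expansion_map N alpha x = N%:R / x - (d%:~R - 1) /\ y < d%:~R.
  move=> /andP[x1 x2] y.
  have xE := digitE x; rewrite gt_eqF// in xE; have {}xE := xE isT.
  have : domain alpha x by rewrite /domain /= in_itv/= !ltW.
  rewrite hcyl /expansion_map => -[[_ e]|[_ e]]; [left|right]; rewrite e ?dB; split => //.
    by rewrite -e xE floor_le.
  by have := floorD1_gt y; rewrite -xE e subrK.
split => //.
- by lra.
- by rewrite divfK// gt_eqF.
- exact: fixed_point_gt0.
- exact: fixed_pointE.
- exact: fixed_point_gt0.
- by rewrite -dB; exact: fixed_pointE.
- by lra.
- by lra.
- move=> x /andP[x1 x2]; have [|[-> //]|[_]] := digits x.
    by rewrite x1 (lt_trans x2 pa1).
  rewrite ltrBlDr ltr_pdivrMr; last by lra.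
  by move: x2; rewrite ltr_pdivlMr//; lra.
- move=> x /andP[x1 x2]; have [|[_]|[-> //]] := digits x.
    by rewrite x2 andbT; apply: le_lt_trans x1.
  have x0 : 0 < x by apply: lt_trans x1; apply: lt_le_trans ap.
  rewrite lerBrDr ler_pdivlMr//.
  by move: x1; rewrite ltr_pdivrMr//; lra.
Qed.

Lemma itv_subset_domain (R : realType) (alpha a b : R) : a < b ->
  `]a, b[%classic `<=` domain alpha -> alpha <= a /\ b <= alpha + 1.
Proof.
move=> ab sub; split; rewrite leNgt; apply/negP => h.
  have /sub : `]a, b[%classic ((a + Num.min b alpha) / 2).
    rewrite /= in_itv/=.
    have : a < Num.min b alpha by rewrite lt_min ab.
    have : Num.min b alpha <= b by rewrite ge_min lexx.
    by move=> *; apply/andP; split; lra.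
  have : Num.min b alpha <= alpha by rewrite ge_min lexx orbT.
  by rewrite /domain /= in_itv/= => ? /andP[? _]; lra.
have /sub : `]a, b[%classic ((b + Num.max a (alpha + 1)) / 2).
  rewrite /= in_itv/=.
  have : Num.max a (alpha + 1) < b by rewrite gt_max ab.
  have : a <= Num.max a (alpha + 1) by rewrite le_max lexx.
  by move=> *; apply/andP; split; lra.
have : alpha + 1 <= Num.max a (alpha + 1) by rewrite le_max lexx orbT.
by rewrite /domain /= in_itv/= => ? /andP[_ ?]; lra.
Qed.

Theorem theorem5 (R : realType) (N : nat) (alpha : R) (d : int)
  (hN : (2 <= N)%N)
  (halpha0 : 0 < alpha)
  (halpha : alpha <= Num.sqrt N%:R - 1)
  (hd : d = digit N alpha alpha)
  (hd1 : d - 1 = digit N alpha (alpha + 1))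
  (hcyl : domain alpha = cylinder N alpha d `|` cylinder N alpha (d - 1))
  (hleft : fixed_point N (d - 1) <= expansion_map N alpha alpha)
  (hright : expansion_map N alpha (alpha + 1) <= fixed_point N d) :
  gapless N alpha.
Proof.
have H := overlapping_expansion_map hN halpha0 halpha hd hd1 hcyl hleft hright.
move=> a b [ab sub avoided _].
have [al br] := itv_subset_domain ab sub.
have visited := ae_visits_infinitely_often H al ab br.
have : (@lebesgue_measure R).-negligible `]alpha, alpha + 1[%classic.
  apply: negligibleS (negligibleU visited avoided) => x xI.
  have [vx|nvx] := pselect ((\bigcap_n0 visits (expansion_map N alpha) a b n0) x);
    last by left.
  right => /= hx.
  have /hx[n0 hn0] : domain alpha x.
    by move: xI; rewrite /domain /= !in_itv/= => /andP[? ?]; rewrite !ltW.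
  by have [n [n0n hn]] := vx n0 I; apply: (hn0 n n0n); rewrite /= in_itv.
move=> nI; have : @lebesgue_measure R `]alpha, alpha + 1[%classic = 0%E.
  exact: (negligibleP lebesgue_measure (measurable_itv _)).1 nI.
rewrite lebesgue_measure_itv/= lte_fin ltrDl ltr01 -EFinB addrAC subrr add0r.
by move=> /eqP; rewrite eqe oner_eq0.
Qed.
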